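(* Let $\mathcal{R}=(\mathcal{D}(\mathcal{H}),\mathcal{F},\mathcal{O},\mu)$ be a static resource theory on an $n$-partite finite-dimensional Hilbert space $\mathcal{H}=\bigotimes_{j=1}^n\mathcal{H}^{A_j}$ such that all LOSR operations belong to the set of free operations $\mathcal{O}$ and the resource monotone is transposition invariant, i.e. $\mu(\rho)=\mu(\rho^T)$ for all $\rho\in\mathcal{D}(\mathcal{H})$. Then for every expectation-based $(\mathcal{R},c,0,m)$-resource characterization protocol there exists an $(\mathcal{R},c',0,m)$-MDI resource characterization protocol with $c'\le c$.
   Context: Notation. $\mathcal{D}(\mathcal{H})$ is the set of density operators on $\mathcal{H}$. $T$ denotes transposition in a fixed product basis. A POVM on $\mathcal{K}$ with finite outcome set $\mathcal{X}$ is a family $(\Pi_x)_{x\in\mathcal{X}}$ of positive semidefinite operators summing to the identity. Static resource theory. A quadruple $\mathcal{R}=(\mathcal{D}(\mathcal{H}),\mathcal{F},\mathcal{O},\mu)$: $\mathcal{F}\subseteq\mathcal{D}(\mathcal{H})$ are the free states, $\mathcal{O}$ is a set of maps $\mathcal{D}(\mathcal{H})\to\mathcal{D}(\mathcal{H})$ (free operations), and $\mu:\mathcal{D}(\mathcal{H})\to[0,\infty)$ is a resource monotone: $\mu(\rho)=0$ for $\rho\in\mathcal{F}$, and $\mu(o(\rho))\le\mu(\rho)$ for all $\rho$ and $o\in\mathcal{O}$. LOSR. A local operation and shared randomness (LOSR) operation on $\bigotimes_j\mathcal{H}^{A_j}$ is a map $\sum_\nu\pi(\nu)\bigotimes_{j=1}^n\Phi^{A_j}_\nu$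 with $\pi$ a probability distribution and each $\Phi^{A_j}_\nu$ a quantum channel (CPTP map) on $\mathcal{H}^{A_j}$. Resource characterization protocol. It accepts or rejects the statement ''$\mu(\rho)>m$'' about an unknown state $\rho\in\mathcal{D}(\mathcal{H})$. It is an $(\mathcal{R},c,s,m)$-protocol if: (completeness) when $\mu(\rho)>m$ it rejects with probability $c$; (soundness) when $\mu(\rho)\le m$ it accepts with probability $s$. The protocols considered are deterministic functions of exact (infinite-sample) statistics; the probability in $c$ comes from the unknown $\rho$ being drawn from a prior distribution (the same prior for all protocols compared), so $c$ is the prior probability of rejection conditioned on $\mu(\rho)>m$. Soundness $s=0$ means that every $\rho$ with $\mu(\rho)\le m$ is rejected. Expectation-based protocol. A protocol given by a function $f:\mathbb{R}^M\to\mathbb{R}$ and Hermitian observables $\mathcal{W}_1,\dots,\mathcal{W}_M$, with $\mathcal{W}_k$ acting on $\mathcal{H}^{\otimes N_k}$, which accepts iff $C(\rho)<0$, where $C(\rho)=f[\mathrm{tr}(\mathcal{W}_1\rho^{\otimes N_1}),\dots,\mathrm{tr}(\mathcal{W}_M\rho^{\otimes N_M})]$ (evaluated with trusted devices). Measurement-device-independent (MDI) protocol. The protocol is viewed as a game between Alice (experimenter) and Eve (who controls the measurement devices). Alice specifies trusted local ancillary input states $\omega^{A'_j}_{k_j}\in\mathcal{D}(\mathcal{H}^{A'_j})$ ($k_j$ in finite index sets), local POVMs $\Pi^{A_jA'_j}$ on $\mathcal{H}^{A_j}\otimes\mathcal{H}^{A'_j}$ with outcome sets $\mathcal{X}_j$,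 and a decision rule which accepts or rejects as a function of the received statistics $\{P(i_1,\dots,i_n|k_1,\dots,k_n)\}$. The ancillary states are prepared faithfully, but instead of $\bigotimes_j\Pi^{A_jA'_j}$ Eve may implement any mixture of local POVMs $\sum_\nu\pi(\nu)\bigotimes_{j=1}^n\Xi^{A_jA'_j}_\nu$ with the same outcome sets, where $\pi$ is a probability distribution (pre-shared randomness) and each $\Xi_\nu^{A_jA'_j}$ is a POVM on $\mathcal{H}^{A_j}\otimes\mathcal{H}^{A'_j}$ with outcomes in $\mathcal{X}_j$. Eve manipulates the procedure once: her choice is fixed throughout the protocol and does not depend on $k_1,\dots,k_n$. The resulting statistics are $$P(i_1,\dots,i_n|k_1,\dots,k_n)=\mathrm{tr}\Big[\Big(\sum_\nu\pi(\nu)\bigotimes_{j}\Xi^{A_jA'_j}_{\nu;i_j}\Big)\Big(\rho\otimes\bigotimes_j\omega^{A'_j}_{k_j}\Big)\Big].$$ Eve knows $\rho$, and her goal is to make Alice accept. Thus, in an MDI protocol, $\rho$ counts as accepted if some admissible manipulation by Eve (including the faithful one) makes Alice accept, and as rejected if Alice rejects under all of Eve's admissible manipulations; soundness $0$ means that for every $\rho$ with $\mu(\rho)\le m$ Alice rejects under every admissible manipulation. *)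

(* Defs.v *)
(* MathComp / MathComp-Analysis; the complex numbers are R[i] for R : realType *)
From HB Require Import structures.
From mathcomp Require Import all_boot all_order all_algebra.
From mathcomp Require Import all_classical all_reals all_analysis.
From mathcomp Require Import complex.

Set Implicit Arguments.
Unset Strict Implicit.
Unset Printing Implicit Defensive.

Import Order.TTheory GRing.Theory Num.Theory.
Import numFieldNormedType.Exports.

Local Open Scope classical_set_scope.
Local Open Scope ring_scope.
Local Open Scope sesquilinear_scope.

(* The Hilbert space with orthonormal basis indexed by the finite type T is
   C^T; an operator on it is a #|T| x #|T| matrix, row and column numbers being
   matched with basis labels by [enum_rank] / [enum_val]. *)
Notation op R T := 'M[R[i]]_#|{: T}|.

Section Operators.
Context {R : realType}.

Definition ent (T : finType) (X : op R T) (a b : T) : R[i] :=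
  X (enum_rank a) (enum_rank b).

Definition of_ent (T : finType) (F : T -> T -> R[i]) : op R T :=
  \matrix_(x, y) F (enum_val x) (enum_val y).

(* On R[i], [0 <= z] means that z is real and nonnegative. *)
Definition psd (T : finType) (X : op R T) : Prop :=
  forall v : 'cV[R[i]]_#|{: T}|, 0 <= (v ^t* *m X *m v) 0 0.

Definition tensor (I : finType) (B : I -> finType) (X : forall i, op R (B i)) :
    op R {dffun forall i : I, B i} :=
  of_ent (fun a b : {dffun forall i : I, B i} => \prod_(i : I) ent (X i) (a i) (b i)).

Definition ketbra (T : finType) (a b : T) : op R T :=
  delta_mx (enum_rank a) (enum_rank b).

(* Tensor product of linear maps, determined by its action on the product
   matrix units. *)
Definition tensor_map (I : finType) (B : I -> finType)
    (Phi : forall i, op R (B i) -> op R (B i))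
    (X : op R {dffun forall i : I, B i}) : op R {dffun forall i : I, B i} :=
  \sum_(a : {dffun forall i : I, B i}) \sum_(b : {dffun forall i : I, B i})
    ent X a b *: tensor (fun i => Phi i (ketbra (a i) (b i))).

(* [ampliate Phi] is the map Phi (x) id on operators on C^T (x) C^E. *)
Definition ampliate (T E : finType) (Phi : op R T -> op R T)
    (X : op R (T * E)%type) : op R (T * E)%type :=
  of_ent (fun x y =>
    ent (Phi (of_ent (fun a b => ent X (a, x.2) (b, y.2)))) x.1 y.1).

Definition channel (T : finType) (Phi : op R T -> op R T) : Prop :=
  [/\ linear Phi,
      forall (E : finType) (X : op R (T * E)%type), psd X -> psd (ampliate Phi X)
    & forall X, \tr (Phi X) = \tr X].

Definition povm (O T : finType) (E : O -> op R T) : Prop :=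
  (forall x, psd (E x)) /\ \sum_x E x = 1%:M.

Definition distribution (p : nat -> R) : Prop :=
  (forall k, 0 <= p k) /\ series p @ \oo --> (1 : R).

(* [Y] is the (finite or countable) convex combination of the [X k] with
   weights [p k]; the series converges entrywise. *)
Definition mixture (T : finType) (p : nat -> R) (X : nat -> op R T)
    (Y : op R T) : Prop :=
  forall i j,
    series (fun k => p k * complex.Re (X k i j)) @ \oo --> complex.Re (Y i j) /\
    series (fun k => p k * complex.Im (X k i j)) @ \oo --> complex.Im (Y i j).

End Operators.

(* The type D(H) of density operators. *)
Record state (R : realType) (T : finType) := State {
  state_op :> op R T;
  state_psd : psd state_op;
  state_tr1 : \tr state_op = 1 }.

Lemma psd_trmx (R : realType) (T : finType) (X : op R T) : psd X -> psd X^T.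
Proof.
move=> X0 v; have := X0 (map_mx Num.conj v).
have -> : (v ^t* *m X^T *m v) 0 0 = ((v ^t* *m X^T *m v)^T) 0 0 by rewrite [RHS]mxE.
rewrite !trmx_mul trmxK mulmxA.
suff -> : (map_mx Num.conj v) ^t* = v^T.
  by rewrite -map_trmx trmxK.
by apply/matrixP => i j; rewrite !mxE conjCK.
Qed.

(* Transposition in the fixed product basis. *)
Definition trstate (R : realType) (T : finType) (rho : state R T) : state R T :=
  State (psd_trmx (state_psd rho)) (etrans (mxtrace_tr rho) (state_tr1 rho)).

Record resource_theory (R : realType) (T : finType) := ResourceTheory {
  free_states : set (state R T);
  free_ops : set (state R T -> state R T);
  resource_monotone : state R T -> R;
  monotone_ge0 : forall rho, 0 <= resource_monotone rho;
  monotone_free : forall rho, free_states rho -> resource_monotone rho = 0;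
  monotone_le : forall o rho,
    free_ops o -> resource_monotone (o rho) <= resource_monotone rho }.

Definition LOSR (R : realType) (n : nat) (A : 'I_n -> finType)
    (o : state R {dffun forall j, A j} -> state R {dffun forall j, A j}) : Prop :=
  exists (p : nat -> R) (Phi : nat -> forall j, op R (A j) -> op R (A j)),
    [/\ distribution p, forall k j, channel (Phi k j)
      & forall rho : state R {dffun forall j, A j},
          mixture p (fun k => tensor_map (Phi k) rho) (o rho)].

(* The unknown state is the random state [X], so the prior is the law of [X].
   Outer measures make the ratio meaningful for arbitrary acceptance sets; it is
   the conditional probability of rejection given m < mu whenever the two
   events are measurable, see [reject_prob_measurable]. *)
Definition reject_prob (R : realType) (disp : measure_display)
    (S : measurableType disp) (prior : probability S R) (T : finType)
    (X : S -> state R T) (mu : state R T -> R) (m : R)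
    (accepted : set (state R T)) : R :=
  fine (mu_ext prior [set s | m < mu (X s) /\ ~ accepted (X s)]) /
  fine (mu_ext prior [set s | m < mu (X s)]).

Lemma reject_prob_measurable (R : realType) (disp : measure_display)
    (S : measurableType disp) (prior : probability S R) (T : finType)
    (X : S -> state R T) (mu : state R T -> R) (m : R)
    (accepted : set (state R T)) :
  measurable [set s | m < mu (X s)] ->
  measurable [set s | ~ accepted (X s)] ->
  reject_prob prior X mu m accepted =
    fine (prior ([set s | m < mu (X s)] `&` [set s | ~ accepted (X s)])) /
    fine (prior [set s | m < mu (X s)]).
Proof.
move=> mH mA; rewrite /reject_prob !measurable_mu_extE //.
exact: measurableI.
Qed.

(* A protocol is represented by the set of states that it accepts. This is the
   (mu, c, s, m)-protocol condition with s = 0. *)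
Definition sound_protocol (R : realType) (disp : measure_display)
    (S : measurableType disp) (prior : probability S R) (T : finType)
    (X : S -> state R T) (RT : resource_theory R T) (c m : R)
    (accepted : set (state R T)) : Prop :=
  reject_prob prior X (resource_monotone RT) m accepted = c /\
  (forall rho, resource_monotone RT rho <= m -> ~ accepted rho).

Record exp_protocol (R : realType) (T : finType) := ExpProtocol {
  exp_size : nat;
  exp_copies : 'I_exp_size -> nat;
  exp_obs : forall k, op R {dffun forall _ : 'I_(exp_copies k), T};
  exp_obs_herm : forall k, exp_obs k \is hermsymmx;
  exp_fun : 'rV[R]_exp_size -> R }.

Arguments exp_copies {R T} _ k.
Arguments exp_obs {R T} _ k.

(* The traces are real since the observables are Hermitian. *)
Definition exp_value (R : realType) (T : finType) (E : exp_protocol R T)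
    (rho : state R T) : R :=
  exp_fun (\row_(k < exp_size E) complex.Re (\tr (exp_obs E k *m
    tensor (fun _ : 'I_(exp_copies E k) => rho : op R T)))).

Definition exp_accepts (R : realType) (T : finType) (E : exp_protocol R T) :
    set (state R T) :=
  [set rho | exp_value E rho < 0].

Record mdi_protocol (R : realType) (n : nat) (A : 'I_n -> finType) := MdiProtocol {
  anc : 'I_n -> finType;
  inp : 'I_n -> finType;
  out : 'I_n -> finType;
  anc_state : forall j, inp j -> state R (anc j);
  meas : forall j, out j -> op R (A j * anc j)%type;
  meas_povm : forall j, povm (meas (j := j));
  decide : ((forall j, out j) -> (forall j, inp j) -> R) -> bool }.

Arguments anc_state {R n A} _ {j} _.
Arguments meas {R n A} _ {j} _.
Arguments decide {R n A} _ _.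

(* rho (x) (x)_j omega_j, with the tensor factors reordered as
   (x)_j (H^{A_j} (x) H^{A'_j}). *)
Definition with_anc (R : realType) (n : nat) (A A' : 'I_n -> finType)
    (rho : op R {dffun forall j, A j}) (omega : forall j, op R (A' j)) :
    op R {dffun forall j, (A j * A' j)%type} :=
  of_ent (fun x y : {dffun forall j, (A j * A' j)%type} =>
    ent rho [ffun j => (x j).1] [ffun j => (y j).1] *
    ent (tensor omega) [ffun j => (x j).2] [ffun j => (y j).2]).

(* [P] can be produced on the state rho by a fixed mixture of local POVMs. The
   trace is real since both factors are positive semidefinite. *)
Definition attainable (R : realType) (n : nat) (A : 'I_n -> finType)
    (Q : mdi_protocol R A) (rho : state R {dffun forall j, A j})
    (P : (forall j, out Q j) -> (forall j, inp Q j) -> R) : Prop :=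
  exists (p : nat -> R)
         (Xi : nat -> forall j, out Q j -> op R (A j * anc Q j)%type)
         (E : (forall j, out Q j) -> op R {dffun forall j, (A j * anc Q j)%type}),
    [/\ distribution p, forall k j, povm (Xi k j),
        forall i, mixture p (fun k => tensor (fun j => Xi k j (i j))) (E i)
      & forall i k, P i k = complex.Re (\tr (E i *m
          with_anc rho (fun j => anc_state Q (k j) : op R (anc Q j))))].

(* The honest measurement [meas Q] is one of the manipulations. *)
Definition mdi_accepts (R : realType) (n : nat) (A : 'I_n -> finType)
    (Q : mdi_protocol R A) : set (state R {dffun forall j, A j}) :=
  [set rho | exists P, attainable rho P /\ decide Q P].

(* Main.v *)
Require Import Defs.
From HB Require Import structures.
From mathcomp Require Import all_boot all_order all_algebra.
From mathcomp Require Import all_classical all_reals all_analysis.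
From mathcomp Require Import complex.
From mathcomp Require Import fingroup perm ring.

Import Order.TTheory GRing.Theory Num.Theory.
Import numFieldNormedType.Exports.

Local Open Scope classical_set_scope.
Local Open Scope ring_scope.
Local Open Scope sesquilinear_scope.

Set Implicit Arguments.
Unset Strict Implicit.
Unset Printing Implicit Defensive.

(* Given the expectation-based protocol, the MDI protocol feeds a tomographically
   complete set of states into the ancillas, prescribes a Bell-type measurement
   on every pair A_j A'_j, and accepts when the statistics are the honest ones of
   some state accepted by the original protocol. A state accepted by the latter is
   then accepted under the honest measurement, so no completeness is lost. For
   soundness, a manipulation of the measurements applied to rho teleports rho to
   the ancillas: undoing the correction unitary of every outcome and averaging
   over the outcomes turns each local POVM into a channel, hence the whole
   manipulation into a LOSR operation Lam. If the statistics agree with the honest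
   ones of sigma, tomographic completeness forces Lam(rho) = sigma, so that
   mu(sigma) <= mu(rho) <= m, and sigma is not accepted. *)

(** * Distributivity over dependent families, and factorization of positive forms *)

(** The dependent family is routed through [fprod], which turns each factor into a sum over tagged
    elements of a single type, where ordinary distributivity applies. *)
Lemma prod_sum_dffun (C : comNzRingType) (I : finType) (B : I -> finType)
    (F : forall i, B i -> C) :
  \prod_i \sum_(x : B i) F i x =
  \sum_(f : {dffun forall i : I, B i}) \prod_i F i (f i).
Proof.
pose G i := [ffun x : B i => F i x].
transitivity (\sum_(t : fprod B) \prod_(i in I) G i (t i)).
  rewrite (@big_fprod C 0 1 *%R +%R I B G).
  transitivity (\prod_i \sum_(j in tagged_with B i) untag 0 (G i) j).
    apply: eq_bigr => i _; transitivity (\sum_x G i x).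
      by apply: eq_bigr => x _; rewrite ffunE.
    exact: (@big_tag C 0 +%R I B (fun i x => G i x) i).
  exact: (bigA_distr_big_dep (fun i => [pred j | j \in tagged_with B i])).
rewrite (reindex (@fprod_of_dffun I B)) /=; last first.
  exact/onW_bij/fprod_of_dffun_bij.
by apply: eq_bigr => f _; apply: eq_bigr => i _; rewrite fprodE ffunE.
Qed.

(** Polarization: the form of [A - A ^t*] vanishes, and testing it on e_a + z e_b with z = 0, 1 and
    the imaginary unit kills every entry. *)
Lemma form_ge0_hermsym (C : numClosedFieldType) (n : nat) (A : 'M[C]_n) :
  (forall v : 'cV[C]_n, 0 <= (v ^t* *m A *m v) 0 0) -> A \is hermsymmx.
Proof.
move=> A0; apply/is_hermitianmxP; rewrite expr0 scale1r.
have formE (M : 'M[C]_n) a b z :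
    ((delta_mx a 0 + z *: delta_mx b 0 : 'cV[C]_n) ^t* *m M *m
      (delta_mx a 0 + z *: delta_mx b 0 : 'cV[C]_n)) 0 0 =
    M a a + z * M a b + z^* * M b a + z^* * z * M b b.
  have -> : (delta_mx a 0 + z *: delta_mx b 0 : 'cV[C]_n) ^t* =
      delta_mx 0 a + z^* *: delta_mx 0 b.
    by apply/matrixP => i j; rewrite !mxE rmorphD rmorphM /= !conjC_nat !(andbC (j == _)).
  rewrite mulmxDl -scalemxAl mulmxDr -!scalemxAr !mulmxDl -!scalemxAl -!rowE.
  have rE c d : (row c M *m (delta_mx d 0 : 'cV_n)) 0 0 = M c d.
    rewrite mxE (bigD1 d) //= big1 => [|k kd].
      by rewrite !mxE !eqxx mulr1 addr0.
    by rewrite !mxE (negPf kd) mulr0.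
  have mD (X Y : 'M[C]_1) : (X + Y) 0 0 = X 0 0 + Y 0 0 by rewrite mxE.
  have mZ c (X : 'M[C]_1) : (c *: X) 0 0 = c * X 0 0 by rewrite mxE.
  rewrite !(mD, mZ, rE); ring.
have D0 a b z : let D := A - A ^t* in
    D a a + z * D a b + z^* * D b a + z^* * z * D b b = 0.
  move=> D; rewrite -formE; set v := (_ + _ : 'cV_n).
  rewrite /D mulmxBr mulmxBl.
  (* The form of the adjoint is the conjugate of the form of [A], which is real. *)
  have -> : v ^t* *m A ^t* *m v = (v ^t* *m A *m v) ^t*.
    by rewrite !trmx_mul !map_mxM trmxCK mulmxA.
  have /CrealP := ger0_real (A0 v); move: (_ *m v) => W e.
  by rewrite !mxE e subrr.
apply/matrixP => a b; apply/eqP; rewrite -subr_eq0; apply/eqP.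
pose D := A - A ^t*; have Dd c : D c c = 0.
  by have := D0 c c 0; rewrite /= conjC0 !mul0r !addr0.
have E1 : D a b + D b a = 0.
  by have := D0 a b 1; rewrite /= -/D !Dd conjC1 !mul1r add0r addr0.
have Ei : 'i * (D a b - D b a) = 0.
  by have := D0 a b 'i; rewrite /= -/D !Dd conjCi mulr0 addr0 add0r mulNr mulrBr.
have /eqP := Ei; rewrite mulf_eq0 (negPf (neq0Ci C)) /= => /eqP /subr0_eq e.
have /eqP := E1; rewrite -e -mulr2n mulrn_eq0 /= /D !mxE => /eqP; exact.
Qed.

(** Spectral theorem: in [A = P ^t* *m diag_mx d *m P] the eigenvalues are values of the form on the
    columns of [P ^t*], hence nonnegative, and the factor is sqrt(d) P. *)
Lemma form_ge0_gram (C : numClosedFieldType) (n : nat) (A : 'M[C]_n) :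
  (forall v : 'cV[C]_n, 0 <= (v ^t* *m A *m v) 0 0) ->
  exists G : 'M[C]_n, A = G ^t* *m G.
Proof.
move=> A0; have /hermitian_normalmx /orthomx_spectralP := form_ge0_hermsym A0.
set P := spectralmx A; set d := spectral_diag A => AE.
have PU : P \is unitarymx by exact: spectral_unitarymx.
rewrite invmx_unitary // in AE.
have d0 i : 0 <= d 0 i.
  have := A0 (P ^t* *m delta_mx i 0); rewrite AE trmx_mul map_mxM trmxCK.
  rewrite !mulmxA -3!mulmxA [P *m _]mulmxA.
  rewrite (unitarymxP PU) mul1mx -!mulmxA [P *m _]mulmxA (unitarymxP PU) mul1mx.
  rewrite mul_diag_mx trmx_delta map_delta_mx -rowE !mxE.
  by rewrite !eqxx mulr1.
pose s := \row_i sqrtC (d 0 i).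
exists (diag_mx s *m P); rewrite trmx_mul map_mxM mulmxA -(mulmxA (P ^t*)).
rewrite AE; congr (_ *m _ *m _); rewrite tr_diag_mx map_diag_mx mulmx_diag.
congr diag_mx; apply/rowP => i; rewrite !mxE.
have /= -> : (sqrtC (d 0 i))^* = sqrtC (d 0 i) by rewrite geC0_conj ?sqrtC_ge0.
by rewrite -expr2 sqrtCK.
Qed.

(** * Entries of operators and positive kernels *)

Section Entries.
Context {R : realType}.
Notation C := R[i].

Lemma ent_of_ent (T : finType) (F : T -> T -> C) a b : ent (of_ent F) a b = F a b.
Proof. by rewrite /ent mxE !enum_rankK. Qed.

Lemma eq_ent (T : finType) (X Y : op R T) :
  (forall a b, ent X a b = ent Y a b) -> X = Y.
Proof.
move=> e; apply/matrixP => i j.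
by have := e (enum_val i) (enum_val j); rewrite /ent !enum_valK.
Qed.

Lemma entD (T : finType) (X Y : op R T) a b : ent (X + Y) a b = ent X a b + ent Y a b.
Proof. by rewrite /ent mxE. Qed.

Lemma entZ (T : finType) (z : C) (X : op R T) a b : ent (z *: X) a b = z * ent X a b.
Proof. by rewrite /ent mxE. Qed.

Lemma ent_sum (T I : finType) (X : I -> op R T) a b :
  ent (\sum_i X i) a b = \sum_i ent (X i) a b.
Proof. by rewrite /ent summxE. Qed.

Lemma ent1 (T : finType) (a b : T) : ent (1%:M : op R T) a b = (a == b)%:R.
Proof. by rewrite /ent mxE (inj_eq enum_rank_inj). Qed.

Lemma ent_ketbra (T : finType) (a b x y : T) :
  ent (ketbra a b : op R T) x y = (x == a)%:R * (y == b)%:R.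
Proof. by rewrite /ent mxE !(inj_eq enum_rank_inj) -natrM mulnb. Qed.

Lemma sum_enum_rank (T : finType) (F : 'I_#|{: T}| -> C) :
  \sum_k F k = \sum_(a : T) F (enum_rank a).
Proof. by rewrite (reindex enum_rank) //; exact/onW_bij/enum_rank_bij. Qed.

Lemma trE (T : finType) (X : op R T) : \tr X = \sum_a ent X a a.
Proof. by rewrite /mxtrace sum_enum_rank. Qed.

Lemma entM (T : finType) (X Y : op R T) a b :
  ent (X *m Y) a b = \sum_c ent X a c * ent Y c b.
Proof. by rewrite /ent mxE sum_enum_rank. Qed.

Lemma ent_tensor (I : finType) (B : I -> finType) (X : forall i, op R (B i)) a b :
  ent (tensor X) a b = \prod_i ent (X i) (a i) (b i).
Proof. by rewrite ent_of_ent. Qed.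

Lemma op_ketbra (T : finType) (X : op R T) :
  X = \sum_a \sum_b ent X a b *: ketbra a b.
Proof.
apply: eq_ent => x y; rewrite ent_sum (bigD1 x) //= ent_sum (bigD1 y) //=.
rewrite entZ ent_ketbra !eqxx !mulr1 !big1 ?addr0 // => [a ax|b yb].
  rewrite ent_sum big1 // => b _.
  by rewrite entZ ent_ketbra eq_sym (negPf ax) mul0r mulr0.
by rewrite entZ ent_ketbra eqxx mul1r eq_sym (negPf yb) mulr0.
Qed.

(** Positivity as a kernel of inner products of finite-dimensional vectors. The index type is
    arbitrary, so kernels can be pulled back along any map; each closure property below is a
    construction on the vectors. *)
Definition gram (T : Type) (F : T -> T -> C) : Prop :=
  exists (K : finType) (G : K -> T -> C),
    forall a b, F a b = \sum_k (G k a)^* * G k b.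

Lemma psd_gram (T : finType) (X : op R T) : psd X <-> gram (ent X).
Proof.
split=> [/form_ge0_gram[G XE]|[K [G XE]] v].
  exists {: 'I_#|{: T}|}, (fun k a => G k (enum_rank a)) => a b.
  by rewrite {1}XE /ent mxE; apply: eq_bigr => k _; rewrite !mxE.
pose w k : C := \sum_b G k b * v (enum_rank b) 0.
suff -> : (v ^t* *m X *m v) 0 0 = \sum_k (w k)^* * w k.
  by apply: sumr_ge0 => k _; rewrite mulrC mul_conjC_ge0.
rewrite mxE sum_enum_rank.
transitivity (\sum_b \sum_a \sum_k
   ((G k a * v (enum_rank a) 0)^* * (G k b * v (enum_rank b) 0))).
  apply: eq_bigr => b _; rewrite mxE sum_enum_rank big_distrl /=.
  apply: eq_bigr => a _; rewrite -/(ent X a b) XE !mxE big_distrr big_distrl /=.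
  by apply: eq_bigr => k _; rewrite rmorphM /=; ring.
transitivity (\sum_b \sum_k (w k)^* * (G k b * v (enum_rank b) 0)).
  apply: eq_bigr => b _; rewrite exchange_big; apply: eq_bigr => k _ /=.
  by rewrite -big_distrl /= rmorph_sum.
by rewrite exchange_big; apply: eq_bigr => k _ /=; rewrite -big_distrr.
Qed.

Lemma gram_comp (S T : Type) (h : S -> T) (F : T -> T -> C) :
  gram F -> gram (fun a b => F (h a) (h b)).
Proof. by case=> K [G FE]; exists K, (fun k a => G k (h a)) => a b; rewrite FE. Qed.

Lemma gramT (T : Type) (F : T -> T -> C) : gram F -> gram (fun a b => F b a).
Proof.
case=> K [G FE]; exists K, (fun k a => (G k a)^*) => a b; rewrite FE.
by apply: eq_bigr => k _; rewrite conjCK mulrC.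
Qed.

(** Schur product theorem: the vectors are tensored. *)
Lemma gram_mul (T : Type) (F F' : T -> T -> C) :
  gram F -> gram F' -> gram (fun a b => F a b * F' a b).
Proof.
case=> K [G FE] [K' [G' FE']].
exists (K * K')%type, (fun k a => G k.1 a * G' k.2 a) => a b.
rewrite FE FE' big_distrlr pair_big /=; apply: eq_bigr => k _.
by rewrite rmorphM /=; ring.
Qed.

Lemma gram_rank1 (T : Type) (g : T -> C) : gram (fun a b => (g a)^* * g b).
Proof. by exists 'I_1, (fun=> g) => a b; rewrite big_ord1. Qed.

(** The vectors are placed in a direct sum, indexed by the disjoint union of the [K i]. *)
Lemma gram_sum (T : Type) (I : finType) (F : I -> T -> T -> C) :
  (forall i, gram (F i)) -> gram (fun a b => \sum_i F i a b).
Proof.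
move=> /choice[K] /(_ _)/cid-/all_sig[G FE].
exists {i : I & K i}, (fun k a => G (tag k) (tagged k) a) => a b.
rewrite (eq_bigr _ (fun i _ => FE i a b)).
by rewrite (@sig_big_dep _ _ _ _ _ xpredT (fun=> xpredT)
  (fun i k => (G i k a)^* * G i k b)).
Qed.

Lemma gram_prod (I : finType) (T : I -> Type) (F : forall i, T i -> T i -> C) :
  (forall i, gram (@F i)) ->
  gram (fun a b : forall i, T i => \prod_i F i (a i) (b i)).
Proof.
move=> /(_ _)/cid-/all_sig[K] /(_ _)/cid-/all_sig[G FE].
exists {dffun forall i, K i}.
exists (fun (k : {dffun forall i, K i}) a => \prod_i G i (k i) (a i)) => a b.
rewrite (eq_bigr _ (fun i _ => FE i (a i) (b i))) prod_sum_dffun.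
by apply: eq_bigr => k _; rewrite rmorph_prod -big_split.
Qed.

(** The vectors of the contracted kernel are the sums over the first index of the original ones. *)
Lemma gram_contract (T : finType) (U : Type) (F : T * U -> T * U -> C) :
  gram F -> gram (fun u u' => \sum_a \sum_b F (a, u) (b, u')).
Proof.
case=> K [G FE]; exists K, (fun k u => \sum_a G k (a, u)) => u u'.
under eq_bigr do (under eq_bigr do rewrite FE; rewrite exchange_big /=).
rewrite exchange_big; apply: eq_bigr => k _ /=.
rewrite rmorph_sum big_distrl; apply: eq_bigr => a _.
by rewrite big_distrr.
Qed.

Lemma psd_tensor (I : finType) (B : I -> finType) (X : forall i, op R (B i)) :
  (forall i, psd (X i)) -> psd (tensor X).
Proof.
move=> X0; apply/psd_gram.
have [|K [G GE]] := @gram_prod I B (fun i => ent (X i)).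
  by move=> i; exact/psd_gram.
exists K, (fun k (a : {dffun forall i, B i}) => G k a) => a b.
by rewrite ent_tensor GE.
Qed.

(** The trace is the sum of all entries of the Schur product of [X] with the transpose of [Y];
    contracting that positive kernel down to [unit] leaves a nonnegative number. *)
Lemma mxtrace_psd_ge0 (T : finType) (X Y : op R T) : psd X -> psd Y -> 0 <= \tr (X *m Y).
Proof.
move=> /psd_gram X0 /psd_gram /gramT Y0.
have := gram_mul X0 Y0 => /(gram_comp (fun a : T * unit => a.1)).
case/gram_contract => K [G GE].
suff -> : \tr (X *m Y) = \sum_k (G k tt)^* * G k tt.
  by apply: sumr_ge0 => k _; rewrite mulrC mul_conjC_ge0.
by rewrite -GE trE; apply: eq_bigr => a _; rewrite entM.
Qed.

End Entries.

(** * Teleportation to the ancilla followed by correction *)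

Section Recovery.
Context {R : realType}.
Notation C := R[i].

Lemma sumD (I : finType) (F G : I -> C) : \sum_i F i + \sum_i G i = \sum_i (F i + G i).
Proof. by rewrite big_split. Qed.

(* The kernel of X |-> tr_A [E (X (x) 1)] transposed: the effective operator that
   the measurement operator [E] leaves on the ancilla when [X] is measured. *)
Definition steer (T U V : finType) (pr : T * U -> V) (E : op R V) (X : op R T)
    (c c' : U) : C :=
  \sum_a \sum_b ent X a b * ent E (pr (b, c')) (pr (a, c)).

(** After outcome i the operator left on the ancilla is conjugated by the correction x -> [sg i x]
    |[pm i x]>, and the results are summed. The factor 1/|T| restores the trace. The map [pr]
    identifies system-ancilla labels with those of [E], so that one party and all parties together
    are treated alike. *)
Definition recover (O T U V : finType) (pr : T * U -> V) (sg : O -> T -> C)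
    (pm : O -> T -> U) (E : O -> op R V) (X : op R T) : op R T :=
  of_ent (fun x y => #|T|%:R^-1 *
    \sum_i sg i x * sg i y * steer pr (E i) X (pm i x) (pm i y)).

Lemma gram_scale (T : Type) (z : C) (F : T -> T -> C) :
  0 <= z -> gram F -> gram (fun a b => z * F a b).
Proof.
move=> z0; apply: gram_mul.
have [K [G GE]] := gram_rank1 (fun _ : T => sqrtC z).
exists K, G => a b; rewrite -GE mulrC -normCK ger0_norm ?sqrtC_ge0 //.
by rewrite sqrtCK.
Qed.

(** The core of complete positivity, with [W] as the reference system: each outcome gives a rank-one
    sign kernel times a contraction of [F] with the pulled-back transpose of [E i]. *)
Lemma gram_steer (O T U V W : finType) (pr : T * U -> V) (sg : O -> T -> C)
    (pm : O -> T -> U) (E : O -> op R V) (F : T * W -> T * W -> C) :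
  (forall i x, (sg i x)^* = sg i x) -> (forall i, psd (E i)) -> gram F ->
  gram (fun x y : T * W => \sum_i sg i x.1 * sg i y.1 *
    \sum_a \sum_b F (a, x.2) (b, y.2) *
                  ent (E i) (pr (b, pm i y.1)) (pr (a, pm i x.1))).
Proof.
move=> sgr E0 F0; apply: gram_sum => i; apply: gram_mul.
  have [K [G GE]] := gram_rank1 (fun x : T * W => sg i x.1).
  by exists K, G => x y; rewrite -GE sgr.
apply: (@gram_contract _ _ _ (fun p q : T * (T * W) =>
  F (p.1, p.2.2) (q.1, q.2.2) *
  ent (E i) (pr (q.1, pm i q.2.1)) (pr (p.1, pm i p.2.1)))).
apply: gram_mul; first exact: (gram_comp (fun p : T * (T * W) => (p.1, p.2.2)) F0).
have /psd_gram/gramT Ei := E0 i.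
exact: (gram_comp (fun p : T * (T * W) => pr (p.1, pm i p.2.1)) Ei).
Qed.

(** For the trace, the signs square to 1 and each [pm i] permutes the labels, so that completeness
    of [E] leaves |T| copies of the trace of [X], cancelling the prefactor. *)
Lemma recover_channel (O T V : finType) (pr : T * T -> V) (sg : O -> T -> C)
    (pm : O -> T -> T) (E : O -> op R V) :
  injective pr -> (forall i x, sg i x * sg i x = 1) ->
  (forall i x, (sg i x)^* = sg i x) -> (forall i, injective (pm i)) ->
  (0 < #|T|)%N -> povm E -> channel (recover pr sg pm E).
Proof.
move=> pr_inj sg1 sgr pm_inj T0 [E0 E1]; split.
- move=> z X Y; apply: eq_ent => x y; rewrite entD entZ !ent_of_ent mulrCA -mulrDr.
  congr (_ * _); rewrite mulr_sumr sumD; apply: eq_bigr => i _ /=.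
  rewrite mulrCA -mulrDr; congr (_ * _); rewrite /steer mulr_sumr sumD.
  apply: eq_bigr => a _; rewrite mulr_sumr sumD; apply: eq_bigr => b _ /=.
  by rewrite entD entZ mulrDl mulrA.
- move=> W X /psd_gram X0; apply/psd_gram.
  have /gram_scale := gram_steer pr pm sgr E0 X0.
  move=> /(_ #|T|%:R^-1); rewrite invr_ge0 ler0n => /(_ isT)[K [G GE]].
  exists K, G => x y; rewrite -GE !ent_of_ent; congr (_ * _).
  apply: eq_bigr => i _; congr (_ * _); apply: eq_bigr => a _.
  by apply: eq_bigr => b _; rewrite ent_of_ent.
- move=> X; rewrite !trE; under eq_bigr do rewrite ent_of_ent.
  rewrite -big_distrr exchange_big /=.
  transitivity (#|T|%:R^-1 * \sum_(c : T) \sum_a \sum_b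
      ent X a b * ent (\sum_i E i) (pr (b, c)) (pr (a, c))).
    congr (_ * _); transitivity (\sum_i \sum_c steer pr (E i) X c c).
      apply: eq_bigr => i _; rewrite [RHS](reindex (pm i)) /=; last first.
        exact/onW_bij/injF_bij/pm_inj.
      by apply: eq_bigr => x _; rewrite sg1 mul1r.
    rewrite exchange_big; apply: eq_bigr => c _.
    rewrite exchange_big; apply: eq_bigr => a _.
    rewrite exchange_big; apply: eq_bigr => b _.
    by rewrite ent_sum mulr_sumr.
  rewrite E1 (eq_bigr (fun=> \sum_a ent X a a)) => [|c _].
    rewrite sumr_const -[X in _ * X]mulr_natl mulrA mulVf ?mul1r //.
    by rewrite pnatr_eq0 -lt0n.
  apply: eq_bigr => a _; rewrite (bigD1 a) //= big1 => [|b ba].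
    by rewrite ent1 eqxx mulr1 addr0.
  by rewrite ent1 (inj_eq pr_inj) xpair_eqE (negPf ba) mulr0.
Qed.

Lemma steer_ketbra (T U V : finType) (pr : T * U -> V) (E : op R V) (a b : T) c c' :
  steer pr E (ketbra a b) c c' = ent E (pr (b, c')) (pr (a, c)).
Proof.
rewrite /steer (bigD1 a) //= (bigD1 b) //= ent_ketbra !eqxx !mul1r !big1 ?addr0 //.
  by move=> x xa; rewrite big1 // => y _; rewrite ent_ketbra (negPf xa) !mul0r.
by move=> y yb; rewrite ent_ketbra (negPf yb) mulr0 mul0r.
Qed.

End Recovery.

(** * Tensor products over the parties *)

Section Multipartite.
Context {R : realType} {I : finType} {A : I -> finType}.
Notation C := R[i].

Lemma natr_card_dffun (B : I -> finType) :
  #|{: {dffun forall i, B i}}|%:R = \prod_i #|B i|%:R :> C.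
Proof.
transitivity (\sum_(f : {dffun forall i, B i}) \prod_(i : I) (1 : C)).
  by rewrite -sum1_card natr_sum; apply: eq_bigr => f _; rewrite big1.
rewrite -(prod_sum_dffun (fun i (_ : B i) => 1 : C)).
by apply: eq_bigr => i _; rewrite sumr_const.
Qed.

Lemma tensor1 (B : I -> finType) : tensor (fun i => 1%:M : op R (B i)) = 1%:M.
Proof.
apply: eq_ent => x y; rewrite ent_tensor ent1; case: (x =P y) => [->|/eqP xy].
  by rewrite big1 // => i _; rewrite ent1 eqxx.
have [i xyi] : exists i, x i != y i.
  apply/existsP; apply: contraNT xy => /existsPn e.
  by apply/eqP/ffunP => i; apply/eqP/negPn/e.
by rewrite (bigD1 i) //= ent1 (negPf xyi) mul0r.
Qed.

Lemma tensor_sum (B K : I -> finType) (X : forall i, K i -> op R (B i)) :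
  tensor (fun i => \sum_k X i k) =
  \sum_(k : {dffun forall i, K i}) tensor (fun i => X i (k i)).
Proof.
apply: eq_ent => x y; rewrite ent_sum ent_tensor.
under eq_bigr do rewrite ent_sum.
by rewrite prod_sum_dffun; apply: eq_bigr => k _; rewrite ent_tensor.
Qed.

Lemma tensorZ (B : I -> finType) (z : I -> C) (X : forall i, op R (B i)) :
  tensor (fun i => z i *: X i) = (\prod_i z i) *: tensor X.
Proof.
apply: eq_ent => x y; rewrite entZ !ent_tensor -big_split.
by apply: eq_bigr => i _; rewrite entZ.
Qed.

Lemma tensor_ketbra (B : I -> finType) (a b : {dffun forall i, B i}) :
  tensor (fun i => ketbra (a i) (b i)) = ketbra a b :> op R _.
Proof.
have natE (x y : {dffun forall i, B i}) : (x == y)%:R = \prod_i (x i == y i)%:R :> C.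
  by rewrite -ent1 -tensor1 ent_tensor; apply: eq_bigr => i _; rewrite ent1.
apply: eq_ent => x y; rewrite ent_tensor ent_ketbra !natE -big_split.
by apply: eq_bigr => i _; rewrite ent_ketbra.
Qed.

Lemma tensor_map_id (X : op R {dffun forall i, A i})
    (Phi : forall i, op R (A i) -> op R (A i)) :
  (forall i Y, Phi i Y = Y) -> tensor_map Phi X = X.
Proof.
move=> PhiE; rewrite [RHS]op_ketbra; apply: eq_bigr => a _; apply: eq_bigr => b _.
congr (_ *: _); rewrite -tensor_ketbra; congr tensor.
by apply: functional_extensionality_dep => i; exact: PhiE.
Qed.

(** Regroups the labels of all systems and all ancillas party by party, the order of factors used by
    [with_anc] and by products of local POVMs. *)
Definition pair_dffun {A' : I -> finType}
    (x : {dffun forall i, A i} * {dffun forall i, A' i}) :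
    {dffun forall i, (A i * A' i)%type} := [ffun i => (x.1 i, x.2 i)].

Lemma pair_dffun_inj {A' : I -> finType} : injective (@pair_dffun A').
Proof.
move=> [a c] [b d] /ffunP e; congr (_, _); apply/ffunP => i;
  by have := e i; rewrite !ffunE => -[].
Qed.

Lemma pair_dffun_bij {A' : I -> finType} : bijective (@pair_dffun A').
Proof.
exists (fun f : {dffun forall i, (A i * A' i)%type} =>
  ([ffun i => (f i).1], [ffun i => (f i).2])).
  by move=> x; apply: pair_dffun_inj; apply/ffunP => i; rewrite !ffunE.
by move=> f; apply/ffunP => i; rewrite !ffunE -surjective_pairing.
Qed.

Section TensorRecover.
Context {O : I -> finType} (sg : forall i, O i -> A i -> C)
  (pm : forall i, O i -> A i -> A i).

Definition prod_sign (o : {dffun forall i, O i}) (x : {dffun forall i, A i}) : C :=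
  \prod_i sg (o i) (x i).

Definition prod_act (o : {dffun forall i, O i}) (x : {dffun forall i, A i}) :
    {dffun forall i, A i} := [ffun i => pm (o i) (x i)].

(** Expanding the product over parties of the sums over local outcomes gives a sum over joint
    outcomes in which signs, normalizations and measurement entries factorize. This is what exhibits
    a joint correction as a product of local channels. *)
Lemma tensor_map_recover (E : forall i, O i -> op R (A i * A i)%type)
    (X : op R {dffun forall i, A i}) :
  tensor_map (fun i => recover id (sg (i := i)) (pm (i := i)) (E i)) X =
  recover pair_dffun prod_sign prod_act (fun o => tensor (fun i => E i (o i))) X.
Proof.
apply: eq_ent => x y; rewrite ent_of_ent ent_sum.
transitivity (\sum_a \sum_b ent X a b * (#|{: {dffun forall i, A i}}|%:R^-1 *
    \sum_(o : {dffun forall i, O i}) prod_sign o x * prod_sign o y *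
      ent (tensor (fun i => E i (o i)))
          (pair_dffun (b, prod_act o y)) (pair_dffun (a, prod_act o x)))).
  apply: eq_bigr => a _; rewrite ent_sum; apply: eq_bigr => b _.
  rewrite entZ ent_tensor; congr (_ * _).
  transitivity (\prod_i (#|A i|%:R^-1 * \sum_(o : O i) sg o (x i) * sg o (y i) *
      ent (E i o) (b i, pm o (y i)) (a i, pm o (x i)))).
    apply: eq_bigr => i _; rewrite ent_of_ent; congr (_ * _).
    by apply: eq_bigr => o _; rewrite steer_ketbra.
  rewrite big_split /= natr_card_dffun prodfV prod_sum_dffun; congr (_ * _).
  apply: eq_bigr => o _; rewrite !big_split /=; congr (_ * _).
  by rewrite ent_tensor; apply: eq_bigr => i _; rewrite !ffunE.
rewrite mulr_sumr.
transitivity (\sum_(o : {dffun forall i, O i}) \sum_a \sum_b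
    #|{: {dffun forall i, A i}}|%:R^-1 * (prod_sign o x * prod_sign o y * (ent X a b *
      ent (tensor (fun i => E i (o i)))
          (pair_dffun (b, prod_act o y)) (pair_dffun (a, prod_act o x))))).
  rewrite [RHS]exchange_big; apply: eq_bigr => a _.
  rewrite [RHS]exchange_big; apply: eq_bigr => b _.
  rewrite mulrCA mulr_sumr mulr_sumr; apply: eq_bigr => o _; ring.
apply: eq_bigr => o _; rewrite /steer !mulr_sumr; apply: eq_bigr => a _.
by rewrite !mulr_sumr.
Qed.

End TensorRecover.

End Multipartite.

(** * Countable convex combinations *)

Section Mixtures.
Context {R : realType}.
Notation C := R[i].
Notation Re := complex.Re.
Notation Im := complex.Im.

(** Scalar counterpart of [mixture], through which limits pass entry by entry into linear
    expressions. *)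
Definition cmix (p : nat -> R) (z : nat -> C) (l : C) : Prop :=
  series (fun k => p k * Re (z k)) @ \oo --> Re l /\
  series (fun k => p k * Im (z k)) @ \oo --> Im l.

Lemma cmixD p z w l m : cmix p z l -> cmix p w m -> cmix p (fun k => z k + w k) (l + m).
Proof.
move=> [zr zi] [wr wi]; split.
- have -> : Re (l + m) = Re l + Re m by case: l m {zr zi wr wi} => ? ? [].
  rewrite (_ : series _ = (fun n => series (fun k => p k * Re (z k)) n +
      series (fun k => p k * Re (w k)) n)).
    by apply: cvgD.
  apply/funext => n; rewrite /series /= -big_split; apply: eq_bigr => k _ /=.
  by rewrite -mulrDr; case: (z k) (w k) => ? ? [].
- have -> : Im (l + m) = Im l + Im m by case: l m {zr zi wr wi} => ? ? [].
  rewrite (_ : series _ = (fun n => series (fun k => p k * Im (z k)) n +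
      series (fun k => p k * Im (w k)) n)).
    by apply: cvgD.
  apply/funext => n; rewrite /series /= -big_split; apply: eq_bigr => k _ /=.
  by rewrite -mulrDr; case: (z k) (w k) => ? ? [].
Qed.

Lemma cmixZ p c z l : cmix p z l -> cmix p (fun k => c * z k) (c * l).
Proof.
move=> [zr zi]; split.
- have -> : Re (c * l) = Re c * Re l - Im c * Im l by case: c l {zr zi} => ? ? [].
  rewrite (_ : series _ = (fun n => Re c * series (fun k => p k * Re (z k)) n -
      Im c * series (fun k => p k * Im (z k)) n)).
    by apply: cvgB; apply: cvgM => //; exact: cvg_cst.
  apply/funext => n; rewrite /series /= !mulr_sumr -sumrB; apply: eq_bigr => k _ /=.
  by case: c (z k) => ? ? [? ?] /=; ring.
- have -> : Im (c * l) = Re c * Im l + Im c * Re l by case: c l {zr zi} => ? ? [].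
  rewrite (_ : series _ = (fun n => Re c * series (fun k => p k * Im (z k)) n +
      Im c * series (fun k => p k * Re (z k)) n)).
    by apply: cvgD; apply: cvgM => //; exact: cvg_cst.
  apply/funext => n; rewrite /series /= !mulr_sumr -big_split; apply: eq_bigr => k _ /=.
  by case: c (z k) => ? ? [? ?] /=; ring.
Qed.

Lemma cmix0 p : cmix p (fun=> 0) 0.
Proof.
by split; rewrite (_ : series _ = fun=> 0); try exact: cvg_cst;
  apply/funext => n; rewrite /series /= big1 // => k _; rewrite mulr0.
Qed.

Lemma cmix_sum (J : finType) p (z : J -> nat -> C) (l : J -> C) :
  (forall i, cmix p (z i) (l i)) -> cmix p (fun k => \sum_i z i k) (\sum_i l i).
Proof.
move=> zl; elim: (index_enum J) => [|i s IHs].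
  rewrite big_nil (_ : (fun k => _) = fun=> 0); first exact: cmix0.
  by apply/funext => k; rewrite big_nil.
rewrite big_cons (_ : (fun k => _) = fun k => z i k + \sum_(j <- s) z j k).
  exact: cmixD.
by apply/funext => k; rewrite big_cons.
Qed.

Lemma cmix_unique p z l m : cmix p z l -> cmix p z m -> l = m.
Proof.
move=> [lr li] [mr mi].
have := cvg_unique (@norm_hausdorff _ R) lr mr.
have := cvg_unique (@norm_hausdorff _ R) li mi.
by case: l m {lr li mr mi} => ? ? [? ?] /= -> ->.
Qed.

Lemma cmix_cst p z : Defs.distribution p -> cmix p (fun=> z) z.
Proof.
move=> [_ p1]; suff H (x : R) : series (fun k => p k * x) @ \oo --> x by split; exact: H.
rewrite -[X in _ --> X]mul1r (_ : series _ = fun n => series p n * x).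
  by apply: cvgM => //; exact: cvg_cst.
by apply/funext => n; rewrite /series /= mulr_suml.
Qed.

Lemma complex_ge0 (z : C) : (0 <= z) = (Im z == 0) && (0 <= Re z).
Proof. by case: z => x y; rewrite lecE. Qed.

Lemma cmix_ge0 p z l :
  Defs.distribution p -> (forall k, 0 <= z k) -> cmix p z l -> 0 <= l.
Proof.
move=> [p0 _] z0 [zr zi]; rewrite complex_ge0; apply/andP; split.
  apply/eqP; apply: (cvg_unique (@norm_hausdorff _ R) zi).
  rewrite (_ : series _ = fun=> 0); first exact: cvg_cst.
  apply/funext => n; rewrite /series /= big1 // => k _.
  by have := z0 k; rewrite complex_ge0 => /andP[/eqP -> _]; rewrite mulr0.
apply: (cvgr_to_ge zr); apply: nearW => n; rewrite /series /=.
apply: sumr_ge0 => k _; apply: mulr_ge0 => //.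
by have := z0 k; rewrite complex_ge0 => /andP[_].
Qed.

Lemma mixture_ent (T : finType) p (X : nat -> op R T) (Y : op R T) :
  mixture p X Y <-> forall a b, cmix p (fun k => ent (X k) a b) (ent Y a b).
Proof.
split=> h a b; first exact: h.
by have := h (enum_val a) (enum_val b); rewrite /ent !enum_valK.
Qed.

(** The quadratic form is linear in the entries, so its value at [Y] is the mixture of its values at
    the [X k]. *)
Lemma psd_mixture (T : finType) p (X : nat -> op R T) (Y : op R T) :
  Defs.distribution p -> (forall k, psd (X k)) -> mixture p X Y -> psd Y.
Proof.
move=> dp X0 XY v.
have formE (Z : op R T) : (v ^t* *m Z *m v) 0 0 =
    \sum_i \sum_j (v j 0)^* * v i 0 * Z j i.
  rewrite mxE; apply: eq_bigr => i _; rewrite mxE big_distrl; apply: eq_bigr => j _.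
  by rewrite !mxE /=; ring.
apply: (cmix_ge0 dp (fun k => X0 k v)); rewrite formE.
rewrite (_ : (fun k => _) = fun k => \sum_i \sum_j (v j 0)^* * v i 0 * X k j i).
  by apply: cmix_sum => i; apply: cmix_sum => j; apply: cmixZ; exact: XY.
by apply/funext => k; exact: formE.
Qed.

Lemma povm_mixture (O T : finType) p (X : nat -> O -> op R T) (E : O -> op R T) :
  Defs.distribution p -> (forall k, povm (X k)) ->
  (forall i, mixture p (fun k => X k i) (E i)) -> povm E.
Proof.
move=> dp X0 XE; split=> [i|].
  by apply: (psd_mixture dp) (XE i) => k; case: (X0 k).
apply: eq_ent => a b; apply: cmix_unique (cmix_cst _ dp).
rewrite (_ : (fun=> _) = fun k => \sum_i ent (X k i) a b).
  by rewrite ent_sum; apply: cmix_sum => i; exact: (mixture_ent _ _ _).1.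
by apply/funext => k; rewrite -ent_sum; case: (X0 k) => _ ->.
Qed.

(** Holds because [recover] is linear in the measurement for fixed [X]. *)
Lemma mixture_recover (O T U V : finType) (pr : T * U -> V) (sg : O -> T -> C)
    (pm : O -> T -> U) p (E : nat -> O -> op R V) (F : O -> op R V) (X : op R T) :
  (forall o, mixture p (fun k => E k o) (F o)) ->
  mixture p (fun k => recover pr sg pm (E k) X) (recover pr sg pm F X).
Proof.
move=> EF; apply/mixture_ent => x y; rewrite ent_of_ent.
under eq_fun do rewrite ent_of_ent.
apply: cmixZ; apply: cmix_sum => o; apply: cmixZ; apply: cmix_sum => a.
by apply: cmix_sum => b; apply: cmixZ; exact: (mixture_ent _ _ _).1.
Qed.

(** Point mass at index 0, which presents a single product measurement as a mixture. *)
Lemma distribution_dirac : Defs.distribution (fun k => (k == 0%N)%:R : R).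
Proof.
split=> //; apply: cvg_near_cst; exists 1%N => // n /= n1.
by rewrite /series /= big_ltn // eqxx big_nat_cond big1 ?addr0 // => -[|k].
Qed.

Lemma mixture_dirac (T : finType) (X : op R T) :
  mixture (fun k => (k == 0%N)%:R) (fun=> X) X.
Proof. by apply/mixture_ent => a b; apply: cmix_cst; exact: distribution_dirac. Qed.

End Mixtures.

(** * The Bell-type measurement with signed permutations *)

Section Measurement.
Context {R : realType} {T : finType}.
Notation C := R[i].
Hypothesis T_gt0 : (0 < #|T|)%N.

(** Outcome labels: averaging over the signs removes off-diagonal terms and averaging over the
    permutations spreads the labels uniformly, without choosing a group structure on [T]. *)
Definition signed_perm := prod {ffun T -> bool} {perm T}.

Definition sgn (o : signed_perm) (x : T) : C := (-1) ^+ o.1 x.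

Definition perm_part (o : signed_perm) (x : T) : T := o.2 x.

Definition graph_vec (o : signed_perm) (x : T * T) : C :=
  sgn o x.1 * (x.2 == perm_part o x.1)%:R.

(* A Bell measurement whose Weyl-Heisenberg unitaries are replaced by the signed
   permutation matrices: it projects on the vectors sum_a sgn(a) |a, o(a)>. *)
Definition bell (o : signed_perm) : op R (T * T)%type :=
  of_ent (fun x y => #|T|%:R / #|{: signed_perm}|%:R *
    ((graph_vec o x)^* * graph_vec o y)).

Lemma sgn_conj o x : (sgn o x)^* = sgn o x.
Proof. by rewrite /sgn rmorphXn rmorphN1. Qed.

Lemma sgn_sqr o x : sgn o x * sgn o x = 1.
Proof. by rewrite /sgn -exprD addnn -mul2n exprM sqrrN expr1n expr1n. Qed.

Lemma perm_part_eq o x y : (perm_part o x == perm_part o y) = (x == y).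
Proof. exact: (inj_eq perm_inj). Qed.

Lemma card_signed_perm_neq0 : #|{: signed_perm}|%:R != 0 :> C.
Proof. by rewrite pnatr_eq0 -lt0n; apply/card_gt0P; exists ([ffun=> false], 1%g). Qed.

Lemma card_neq0 : #|T|%:R != 0 :> C.
Proof. by rewrite pnatr_eq0 -lt0n. Qed.

(** For distinct labels, flipping the sign at [a] is an involution that negates every term. *)
Lemma sum_sgn (a b : T) :
  \sum_(s : {ffun T -> bool}) (-1) ^+ s a * (-1) ^+ s b =
  #|{: {ffun T -> bool}}|%:R * (a == b)%:R :> C.
Proof.
case: eqP => [->|/eqP ab].
  rewrite mulr1 -sum1_card natr_sum; apply: eq_bigr => s _.
  by rewrite -exprD addnn -mul2n exprM sqrrN expr1n expr1n.
pose flip (s : {ffun T -> bool}) := [ffun x => s x (+) (x == a)].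
have flipK : involutive flip.
  by move=> s; apply/ffunP => x; rewrite !ffunE -addbA addbb addbF.
set S := \sum_s _; rewrite mulr0; suff /eqP : S = - S.
  by rewrite -addr_eq0 -mulr2n mulrn_eq0 => /eqP.
rewrite {1}/S (reindex_inj (inv_inj flipK)) -sumrN; apply: eq_bigr => s _ /=.
by rewrite !ffunE eqxx eq_sym (negPf ab) addbF signr_addb expr1 mulrN1 mulNr.
Qed.

(** Composing with a transposition shows independence of [c]; summed over all [c], each permutation
    is counted exactly once. *)
Lemma sum_perm_eq (a c : T) :
  \sum_(s : {perm T}) (c == s a)%:R = #|{: {perm T}}|%:R / #|T|%:R :> C.
Proof.
have const c' :
    \sum_(s : {perm T}) (c == s a)%:R = \sum_(s : {perm T}) (c' == s a)%:R :> C.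
  rewrite (reindex_inj (@mulIg _ (tperm c c'))); apply: eq_bigr => s _ /=.
  rewrite permM -{1}(tpermR c c') (inj_eq perm_inj); exact: erefl.
apply: (mulIf card_neq0); rewrite divfK ?card_neq0 //.
transitivity (\sum_(c' : T) \sum_(s : {perm T}) (c' == s a)%:R : C).
  by rewrite -(eq_bigr _ (fun c' _ => const c')) sumr_const mulr_natr.
rewrite exchange_big -sum1_card natr_sum; apply: eq_bigr => s _ /=.
by rewrite (bigD1 (s a)) //= eqxx big1 ?addr0 // => c' /negPf ->.
Qed.

(** The sign sum forces equal system labels, then the permutations force equal ancilla labels, and
    the two counts cancel the prefactor of [bell]. *)
Lemma povm_bell : povm bell.
Proof.
split=> [q|].
  have w0 : 0 <= #|T|%:R / #|{: signed_perm}|%:R :> C by rewrite divr_ge0 ?ler0n.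
  have [K [G GE]] := gram_scale w0 (gram_rank1 (graph_vec q)).
  apply/psd_gram; exists K, G => a b.
  by rewrite ent_of_ent GE.
apply: eq_ent => -[a c] [b d]; rewrite ent_sum ent1.
under eq_bigr do rewrite ent_of_ent.
rewrite -big_distrr /=.
transitivity (#|T|%:R / #|{: signed_perm}|%:R *
  \sum_(s : {ffun T -> bool}) \sum_(p : {perm T})
    ((-1) ^+ s a * (-1) ^+ s b) * ((c == p a)%:R * (d == p b)%:R) : C).
  congr (_ * _); rewrite pair_big; apply: eq_bigr => o _.
  by rewrite /graph_vec rmorphM /= sgn_conj conjC_nat /sgn /perm_part /=; ring.
rewrite -big_distrlr /= sum_sgn xpair_eqE.
case: eqP => [<-|_]; last by rewrite mulr0 mul0r mulr0.
case: eqP => [<-|/eqP cd] /=.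
  under [X in _ * (_ * X)]eq_bigr do rewrite -natrM mulnb andbb.
  rewrite sum_perm_eq mulr1 card_prod natrM.
  have := card_signed_perm_neq0; rewrite card_prod natrM mulf_eq0 negb_or.
  by case/andP => u v; have w := card_neq0; field; rewrite u v w.
rewrite [X in _ * (_ * X)]big1 ?mulr0 // => p _; rewrite -natrM mulnb.
by case: eqP => [<-|] //=; rewrite eq_sym (negPf cd).
Qed.

(** Honest teleportation is perfect: for each outcome only the term a = x, b = y survives, its signs
    square away, and all outcomes contribute equally. *)
Lemma recover_bell (X : op R T) : recover id sgn perm_part bell X = X.
Proof.
apply: eq_ent => x y; rewrite ent_of_ent.
transitivity (#|T|%:R^-1 * \sum_(o : signed_perm)
    (#|T|%:R / #|{: signed_perm}|%:R * ent X x y)).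
  congr (_ * _); apply: eq_bigr => o _.
  rewrite /steer (bigD1 x) //= (bigD1 y) //= !big1 ?addr0 => [|a ax|b yb].
  - rewrite ent_of_ent /graph_vec /= !eqxx !mulr1 sgn_conj.
    by rewrite -[RHS]mul1r -(sgn_sqr o x) -[RHS]mulr1 -(sgn_sqr o y); ring.
  - rewrite big1 // => b _; rewrite ent_of_ent /graph_vec /=.
    by rewrite perm_part_eq perm_part_eq (eq_sym x) (negPf ax) !mulr0.
  - rewrite ent_of_ent /graph_vec /=.
    by rewrite !perm_part_eq (eq_sym y) (negPf yb) mulr0 conjC0 mul0r !mulr0.
rewrite sumr_const -[X in _ * X]mulr_natl.
have := card_signed_perm_neq0; have := card_neq0 => u v.
by field; rewrite u v.
Qed.

End Measurement.

(** * Tomographically complete input states *)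

Section Inputs.
Context {R : realType} {T : finType}.
Notation C := R[i].
Hypothesis T_gt0 : (0 < #|T|)%N.

(** The trace is the sum of the squared moduli of all components of the Gram vectors. *)
Lemma psd_tr0 (X : op R T) : psd X -> \tr X = 0 -> X = 0.
Proof.
move=> /psd_gram[K [G XE]]; rewrite trE => tr0.
have G0 k a : G k a = 0.
  have ge0 b j : 0 <= (G j b)^* * G j b by rewrite mulrC mul_conjC_ge0.
  have /eqP := tr0; rewrite psumr_eq0 => [|b _]; last by rewrite XE; exact: sumr_ge0.
  move=> /allP/(_ a (mem_index_enum a)) /=; rewrite XE psumr_eq0 => [|j _] //.
  move=> /allP/(_ k (mem_index_enum k)) /=.
  by rewrite mulf_eq0 conjC_eq0 orbb => /eqP.
apply: eq_ent => a b; rewrite [RHS]mxE XE big1 // => k _.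
by rewrite !G0 mulr0.
Qed.

Lemma psd_state (X : op R T) :
  psd X -> exists rho : state R T, X = \tr X *: (rho : op R T).
Proof.
have scale (Y : op R T) z : 0 <= z -> psd Y -> psd (z *: Y).
  move=> z0 Y0 v; rewrite -scalemxAr -scalemxAl mxE; exact: mulr_ge0.
have pos (Y : op R T) : psd Y -> \tr Y != 0 ->
    exists rho : state R T, rho = (\tr Y)^-1 *: Y :> op R T.
  move=> Y0 trY.
  have Y'0 : psd ((\tr Y)^-1 *: Y).
    apply: scale => //; rewrite invr_ge0 trE; apply: sumr_ge0 => a _.
    have /psd_gram[K [G ->]] := Y0; apply: sumr_ge0 => k _.
    by rewrite mulrC mul_conjC_ge0.
  have tr1 : \tr ((\tr Y)^-1 *: Y) = 1 by rewrite mxtraceZ mulVf.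
  by exists (State Y'0 tr1).
move=> X0; case: (eqVneq (\tr X) 0) => [tr0|trX].
  (* With zero trace the operator vanishes and any state serves; a basis state exists since [T] is
     nonempty. *)
  have /card_gt0P[a _] := T_gt0.
  have aa0 : psd (ketbra a a : op R T).
    apply/psd_gram; have [K [G GE]] := @gram_rank1 R T (fun x => (x == a)%:R).
    by exists K, G => x y; rewrite -GE ent_ketbra conjC_nat.
  have [|rho _] := pos _ aa0.
    rewrite trE (bigD1 a) //= big1 => [|b /negPf ba]; rewrite ent_ketbra ?ba ?mul0r //.
    by rewrite !eqxx mulr1 addr0 oner_eq0.
  by exists rho; rewrite tr0 scale0r; exact: psd_tr0.
have [rho rhoE] := pos X X0 trX.
by exists rho; rewrite rhoE scalerA divff // scale1r.
Qed.

(** Polarization: |a><b| is a quarter of the sum over t < 4 of i^t |v_t><v_t|, where v_t = |a> + i^t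
    |b>. The positive operators |v_t><v_t| are multiples of states. *)
Lemma tomographically_complete_states :
  exists (K : finType) (omega : K -> state R T), forall X : op R T,
    exists z : K -> C, X = \sum_k z k *: (omega k : op R T).
Proof.
pose v (k : T * T * 'I_4) (x : T) : C :=
  (x == k.1.1)%:R + 'i ^+ k.2 * (x == k.1.2)%:R.
pose V k : op R T := of_ent (fun x y => v k x * (v k y)^*).
have V0 k : psd (V k).
  apply/psd_gram; have [K [G GE]] := gramT (gram_rank1 (v k)).
  by exists K, G => x y; rewrite -GE ent_of_ent mulrC.
have /choice[omega omegaE] := fun k => psd_state (V0 k).
exists (T * T * 'I_4)%type, omega => X.
exists (fun k : T * T * 'I_4 => ent X k.1.1 k.1.2 * 'i ^+ k.2 / 4%:R * \tr (V k)).
pose F (k : T * T * 'I_4) := (ent X k.1.1 k.1.2 * 'i ^+ k.2 / 4%:R) *: V k.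
transitivity (\sum_k F k); last first.
  by apply: eq_bigr => k _; rewrite /F {1}[V k]omegaE scalerA.
transitivity (\sum_(ab : T * T) \sum_(t : 'I_4) F (ab, t)); last first.
  by rewrite pair_big; apply: eq_bigr => -[].
rewrite {1}[X]op_ketbra pair_big /=.
apply: eq_bigr => -[a b] _; apply: eq_ent => x y.
rewrite ent_sum entZ ent_ketbra.
under eq_bigr do rewrite /F entZ ent_of_ent /v /=
  rmorphD rmorphM rmorphXn /= conjCi !conjC_nat.
rewrite !big_ord_recr big_ord0 /=.
have i2 : ('i : C) ^+ 2 = -1 by exact: sqrCi.
have i3 : ('i : C) ^+ 3 = - 'i by rewrite exprS i2 mulrN1.
have Ni3 : (- 'i : C) ^+ 3 = 'i by rewrite exprS sqrrN i2 mulrN1 opprK.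
rewrite !expr0 !expr1 sqrrN i2 i3 Ni3.
move: (x == a)%:R (x == b)%:R (y == a)%:R (y == b)%:R (ent X a b) => p q r s w.
(* Adding this multiple of i^2 + 1 = 0 makes the identity hold with the imaginary unit treated as a
   free variable. *)
have -> : w * (p * s) = w * (p * s) + w / 2%:R * (q * r - p * s) * ('i ^+ 2 + 1).
  by rewrite i2 addNr mulr0 addr0.
by field.
Qed.

End Inputs.

(** * Positivity of channels, product POVMs and equality of states *)

(** Complete positivity with a one-dimensional reference system. *)
Lemma channel_psd (R : realType) (T : finType) (Phi : op R T -> op R T) (X : op R T) :
  channel Phi -> psd X -> psd (Phi X).
Proof.
case=> _ cp _ /psd_gram X0.
pose Xu : op R (T * unit)%type := of_ent (fun x y => ent X x.1 y.1).
have /cp/psd_gram[K [G GE]] : psd Xu.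
  apply/psd_gram; have [K [G GE]] := gram_comp (fun x : T * unit => x.1) X0.
  by exists K, G => x y; rewrite ent_of_ent GE.
apply/psd_gram; exists K, (fun k a => G k (a, tt)) => a b.
rewrite -GE ent_of_ent /=; congr (ent (Phi _) _ _); apply: eq_ent => x y.
by rewrite !ent_of_ent.
Qed.

Lemma povm_tensor (R : realType) (I : finType) (B O : I -> finType)
    (E : forall i, O i -> op R (B i)) :
  (forall i, povm (E i)) ->
  povm (fun o : {dffun forall i, O i} => tensor (fun i => E i (o i))).
Proof.
move=> E0; split=> [q|]; first by apply: psd_tensor => i; case: (E0 i).
rewrite -tensor_sum -tensor1; congr tensor.
by apply: functional_extensionality_dep => i; case: (E0 i).
Qed.

Lemma eq_state (R : realType) (T : finType) (rho sigma : state R T) :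
  rho = sigma :> op R T -> rho = sigma.
Proof.
case: rho sigma => X X0 X1 [Y Y0 Y1] /= XY; rewrite -XY in Y0 Y1 *.
by congr State; exact: Prop_irrelevance.
Qed.

(** * What the statistics determine *)

Section Statistics.
Context {R : realType} {n : nat} {A A' : 'I_n -> finType}.
Notation C := R[i].
Notation dsteer := (@steer R _ _ _ (@pair_dffun _ A A')).

(** The measurement and the state enter the statistics only through the [steer] kernel, paired here
    with the ancilla operator. *)
Lemma tr_with_anc (M : op R {dffun forall j, (A j * A' j)%type})
    (rho : op R {dffun forall j, A j}) (Y : forall j, op R (A' j)) :
  \tr (M *m with_anc rho Y) =
  \sum_c \sum_c' dsteer M rho c c' * ent (tensor Y) c c'.
Proof.
have pd1 x : [ffun j => (@pair_dffun _ A A' x j).1] = x.1.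
  by apply/ffunP => j; rewrite !ffunE.
have pd2 x : [ffun j => (@pair_dffun _ A A' x j).2] = x.2.
  by apply/ffunP => j; rewrite !ffunE.
have pair_dffunE := onW_bij predT (@pair_dffun_bij _ A A').
transitivity (\sum_c \sum_c' \sum_a \sum_b
    ent rho a b * ent M (pair_dffun (b, c')) (pair_dffun (a, c)) * ent (tensor Y) c c').
  rewrite trE (reindex pair_dffun) //=.
  transitivity (\sum_bc' \sum_ac ent M (pair_dffun bc') (pair_dffun ac) *
      (ent rho ac.1 bc'.1 * ent (tensor Y) ac.2 bc'.2)).
    apply: eq_bigr => -[b c'] _; rewrite entM (reindex pair_dffun) //=.
    apply: eq_bigr => -[a c] _; rewrite [X in _ * X]ent_of_ent.
    by rewrite !pd1 !pd2.
  transitivity (\sum_b \sum_c' \sum_a \sum_c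
      ent M (pair_dffun (b, c')) (pair_dffun (a, c)) *
      (ent rho a b * ent (tensor Y) c c')).
    rewrite [RHS]pair_big; apply: eq_bigr => bc' _.
    by rewrite [RHS]pair_big; apply: eq_bigr => -[].
  rewrite [LHS]exchange_big [RHS]exchange_big /=; apply: eq_bigr => c' _.
  rewrite [LHS]exchange_big [RHS]exchange_big /=; apply: eq_bigr => a _.
  rewrite [LHS]exchange_big /=; apply: eq_bigr => c _; apply: eq_bigr => b _; ring.
apply: eq_bigr => c _; apply: eq_bigr => c' _; rewrite big_distrl.
by apply: eq_bigr => a _; rewrite big_distrl.
Qed.

Lemma psd_with_anc (rho : op R {dffun forall j, A j}) (Y : forall j, op R (A' j)) :
  psd rho -> (forall j, psd (Y j)) -> psd (with_anc rho Y).
Proof.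
move=> /psd_gram rho0 /psd_tensor/psd_gram Y0; apply/psd_gram.
have [K [G GE]] := gram_mul
  (gram_comp (fun x : {dffun forall j, (A j * A' j)%type} =>
     [ffun j => (x j).1] : {dffun forall j, A j}) rho0)
  (gram_comp (fun x : {dffun forall j, (A j * A' j)%type} =>
     [ffun j => (x j).2] : {dffun forall j, A' j}) Y0).
by exists K, G => x y; rewrite ent_of_ent GE.
Qed.

Context {K : 'I_n -> finType} (omega : forall j, K j -> state R (A' j)).
Hypothesis omega_complete : forall j (X : op R (A' j)),
  exists z : K j -> C, X = \sum_k z k *: (omega k : op R (A' j)).

Definition statistic (M : op R {dffun forall j, (A j * A' j)%type})
    (rho : state R {dffun forall j, A j}) (k : forall j, K j) : R :=
  complex.Re (\tr (M *m with_anc rho (fun j => omega (k j) : op R (A' j)))).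

(** The traces are multilinear in the ancilla operators, so agreement on a complete set of inputs
    extends to products of matrix units, each of which reads off one kernel entry. *)
Lemma statistic_steer (M M' : op R {dffun forall j, (A j * A' j)%type})
    (rho rho' : state R {dffun forall j, A j}) :
  psd M -> psd M' -> (forall k, statistic M rho k = statistic M' rho' k) ->
  forall c c', dsteer M rho c c' = dsteer M' rho' c c'.
Proof.
move=> M0 M'0 stE.
have ge0 N sigma (k : forall j, K j) : psd N ->
    0 <= \tr (N *m with_anc (sigma : state R {dffun forall j, A j})
                            (fun j => omega (k j) : op R (A' j))).
  move=> N0; apply: (mxtrace_psd_ge0 N0).
  by apply: (psd_with_anc (state_psd sigma)) => j; exact: state_psd.
(* Both traces are nonnegative, hence real, so equal real parts suffice. *)
have trE k : \tr (M *m with_anc rho (fun j => omega (k j) : op R (A' j))) =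
             \tr (M' *m with_anc rho' (fun j => omega (k j) : op R (A' j))).
  have := stE k; have := ge0 M rho k M0; have := ge0 M' rho' k M'0.
  rewrite /statistic !complex_ge0; move: (\tr _) (\tr _) => [a b] [a' b'] /=.
  by move=> /andP[/eqP -> _] /andP[/eqP -> _] ->.
have trD (N : op R {dffun forall j, (A j * A' j)%type})
    (sigma : state R {dffun forall j, A j}) (z : forall j, K j -> C) :
  \tr (N *m with_anc sigma (fun j => \sum_k z j k *: (omega k : op R (A' j)))) =
  \sum_(k : {dffun forall j, K j}) (\prod_j z j (k j)) *
    \tr (N *m with_anc sigma (fun j => omega (k j) : op R (A' j))).
  rewrite tr_with_anc tensor_sum.
  transitivity (\sum_c \sum_c' \sum_(k : {dffun forall j, K j}) (\prod_j z j (k j)) *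
      (dsteer N sigma c c' * ent (tensor (fun j => omega (k j) : op R (A' j))) c c')).
    apply: eq_bigr => c _; apply: eq_bigr => c' _; rewrite ent_sum mulr_sumr.
    by apply: eq_bigr => k _; rewrite tensorZ entZ mulrCA.
  under eq_bigr do rewrite exchange_big.
  rewrite exchange_big; apply: eq_bigr => k _ /=; rewrite tr_with_anc mulr_sumr.
  by apply: eq_bigr => c _; rewrite mulr_sumr.
move=> c c'.
have /(_ _)/cid-/all_sig[z zE] := fun j => omega_complete (ketbra (c j) (c' j)).
have steerE N (sigma : state R {dffun forall j, A j}) : dsteer N sigma c c' =
    \tr (N *m with_anc sigma (fun j => ketbra (c j) (c' j))).
  rewrite tr_with_anc tensor_ketbra (bigD1 c) //= (bigD1 c') //=.
  rewrite ent_ketbra !eqxx !mulr1 !big1 ?addr0 // => [d /negPf dc|d /negPf dc].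
    by rewrite big1 // => d' _; rewrite ent_ketbra dc mul0r mulr0.
  by rewrite ent_ketbra dc !mulr0.
rewrite !steerE.
have -> : (fun j => ketbra (c j) (c' j)) =
    fun j => \sum_k z j k *: (omega k : op R (A' j)).
  by apply: functional_extensionality_dep => j; exact: zE.
by rewrite !trD; apply: eq_bigr => k _; rewrite trE.
Qed.

End Statistics.

(** Outer measure is monotone, and it is finite because [prior] has total mass 1, so [fine] keeps
    the order. *)
Lemma reject_prob_anti (R : realType) (disp : measure_display)
    (S : measurableType disp) (prior : probability S R) (T : finType)
    (X : S -> state R T) (mu : state R T -> R) (m : R) (P Q : set (state R T)) :
  (forall rho, m < mu rho -> P rho -> Q rho) ->
  reject_prob prior X mu m Q <= reject_prob prior X mu m P.
Proof.
move=> PQ; rewrite /reject_prob.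
have ge0 B : (0 <= mu_ext prior B)%E by exact: mu_ext_ge0.
have fin B : mu_ext prior B \is a fin_num.
  rewrite ge0_fin_numE //; apply: (@le_lt_trans _ _ (mu_ext prior setT)).
    exact: le_mu_ext.
  have -> : mu_ext prior setT = prior setT by exact: measurable_mu_extE.
  by rewrite probability_setT ltry.
(* A zero denominator is harmless: its inverse is 0 by convention, still nonnegative. *)
apply: ler_wpM2r; first by rewrite invr_ge0; exact: fine_ge0.
apply: fine_le => //; apply: le_mu_ext => s [ms nQ]; split=> // Ps.
by apply: nQ; exact: PQ.
Qed.

(** * Manipulated measurements as LOSR operations *)

Section TensorBell.
Context {R : realType} {n : nat} {A : 'I_n -> finType}.
Hypothesis A_gt0 : forall j, (0 < #|A j|)%N.
Notation C := R[i].
Notation H := {dffun forall j, A j}.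
Notation outcomes := {dffun forall j, signed_perm (T := A j)}.

Definition bell_recover (E : outcomes -> op R {dffun forall j, (A j * A j)%type}) :
    op R H -> op R H :=
  recover pair_dffun (prod_sign (fun j => @sgn R (A j)))
    (prod_act (fun j => @perm_part (A j))) E.

Lemma card_dffun_gt0 : (0 < #|{: H}|)%N.
Proof.
rewrite lt0n -(@pnatr_eq0 C) natr_card_dffun; apply/prodf_neq0 => j _.
exact: card_neq0.
Qed.

Lemma channel_bell_recover E : povm E -> channel (bell_recover E).
Proof.
apply: recover_channel; last exact: card_dffun_gt0.
- exact: pair_dffun_inj.
- by move=> q x; rewrite /prod_sign -big_split big1 // => j _; exact: sgn_sqr.
- by move=> q x; rewrite rmorph_prod; apply: eq_bigr => j _; exact: sgn_conj.
- move=> q x y /ffunP xy; apply/ffunP => j; have := xy j.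
  by rewrite !ffunE => /perm_inj.
Qed.

Lemma channel_recover_sgn (T : finType) (E : signed_perm (T := T) -> op R (T * T)%type) :
  (0 < #|T|)%N -> povm E -> channel (recover id (@sgn R T) (@perm_part T) E).
Proof.
move=> T0; apply: recover_channel => //.
- exact: sgn_sqr.
- exact: sgn_conj.
- by move=> q x y /perm_inj.
Qed.

Lemma bell_recover_bell (X : op R H) :
  bell_recover (fun q : outcomes => tensor (fun j => bell (q j))) X = X.
Proof.
rewrite /bell_recover -(tensor_map_recover _ _ (fun j => @bell R (A j))).
by apply: tensor_map_id => j; exact: recover_bell.
Qed.

(** The averaged POVM [E] yields a channel, so outputs are states. Linearity in the measurement
    splits that channel into a mixture of corrections for product POVMs, each a product of local
    channels. *)
Lemma LOSR_bell_recover (p : nat -> R)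
    (Xi : nat -> forall j, signed_perm (T := A j) -> op R (A j * A j)%type)
    (E : outcomes -> op R {dffun forall j, (A j * A j)%type}) :
  Defs.distribution p -> (forall k j, povm (Xi k j)) ->
  (forall q : outcomes, mixture p (fun k => tensor (fun j => Xi k j (q j))) (E q)) ->
  exists2 o : state R H -> state R H, LOSR o &
    forall rho, o rho = bell_recover E rho :> op R H.
Proof.
move=> dp Xi0 XiE.
have E0 : povm E by apply: (povm_mixture dp) XiE => k; exact: povm_tensor.
have chE := channel_bell_recover E0.
have [_ _ chtr] := chE.
have tr1 (rho : state R H) : \tr (bell_recover E rho) = 1 by rewrite chtr state_tr1.
exists (fun rho => State (channel_psd chE (state_psd rho)) (tr1 rho)) => //.
exists p, (fun k j => recover id (@sgn R (A j)) (@perm_part (A j)) (Xi k j)).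
split=> // [k j|rho]; first exact: channel_recover_sgn.
under eq_fun do rewrite tensor_map_recover.
exact: mixture_recover.
Qed.

End TensorBell.

Theorem theorem1 (R : realType) (n : nat) (A : 'I_n -> finType)
    (A_gt0 : forall j, (0 < #|A j|)%N)
    (RT : resource_theory R {dffun forall j, A j})
    (LOSR_free : forall o, LOSR o -> free_ops RT o)
    (mu_tr : forall rho, resource_monotone RT rho = resource_monotone RT (trstate rho))
    (disp : measure_display) (S : measurableType disp) (prior : probability S R)
    (X : S -> state R {dffun forall j, A j}) (m c : R)
    (E : exp_protocol R {dffun forall j, A j}) :
  sound_protocol prior X RT c m (exp_accepts E) ->
  exists (c' : R) (Q : mdi_protocol R A),
    sound_protocol prior X RT c' m (mdi_accepts Q) /\ c' <= c.
Proof.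
move=> [<- soundE].
have /(_ _)/cid-/all_sig[K] :=
  fun j => @tomographically_complete_states R (A j) (A_gt0 j).
move=> /(_ _)/cid-/all_sig[omega omega_complete].
pose honest rho (i : forall j, signed_perm (T := A j)) (k : forall j, K j) :=
  statistic omega (tensor (fun j => @bell R (A j) (i j))) rho k.
pose decision P := `[< exists2 rho, exp_accepts E rho & P = honest rho >].
pose Q := @MdiProtocol R n A A K (fun j => signed_perm (T := A j)) omega
  (fun j => @bell R (A j)) (fun j => povm_bell (A_gt0 j)) decision.
exists (reject_prob prior X (resource_monotone RT) m (mdi_accepts Q)), Q.
split; last first.
  (* Completeness: every state accepted by [E] is accepted under the honest measurement, with [rho]
     itself as the witness for [decision]. *)
  apply: reject_prob_anti => rho _ Erho; exists (honest rho); split; last first.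
    by apply/asboolP; exists rho.
  exists (fun k => (k == 0%N)%:R), (fun _ j => @bell R (A j)),
    (fun i => tensor (fun j => @bell R (A j) (i j))).
  split=> //; first exact: distribution_dirac.
    by move=> _ j; exact: povm_bell.
  by move=> i; exact: mixture_dirac.
split=> // rho mu_rho [P [[p [Xi [F [dp Xi0 XiF PE]]]] /asboolP[sigma Esigma Psigma]]].
(* Outcomes of the protocol are plain dependent functions; [G] restricts [F] to their finite type,
   over which outcome sums are taken. *)
pose G (q : {dffun forall j, signed_perm (T := A j)}) := F (fun j => q j).
have XiG (q : {dffun forall j, signed_perm (T := A j)}) :
  mixture p (fun k => tensor (fun j => Xi k j (q j))) (G q) by exact: XiF.
have [Lam /LOSR_free Lam_free LamE] := LOSR_bell_recover A_gt0 dp Xi0 XiG.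
have G0 : povm G by apply: (povm_mixture dp) XiG => k; exact: (povm_tensor (Xi0 k)).
suff Lam_rho : Lam rho = sigma.
  apply: (soundE sigma) Esigma; rewrite -Lam_rho.
  by apply: le_trans mu_rho; exact: monotone_le.
(* Writing [sigma] as its own honest recovery puts both sides in the same form, so they are compared
   outcome by outcome through their [steer] kernels. *)
apply: eq_state; rewrite LamE -[RHS](bell_recover_bell A_gt0).
apply: eq_ent => x y; rewrite !ent_of_ent; congr (_ * _).
apply: eq_bigr => q _; congr (_ * _).
apply: (statistic_steer omega_complete).
- by case: G0.
- by apply: psd_tensor => j; case: (povm_bell (R := R) (A_gt0 j)).
- move=> k; have := PE (fun j => q j) k; rewrite Psigma => /esym; exact.
Qed.
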